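(* Let $f_1,\dots,f_N$ be vectors in $\mathbb{R}^d$. For any $J\subset\{1,\dots,N\}$ let $V_J$ denote the subspace $\mathrm{span}\{f_j: j\in J\}$. Then $f_1,\dots,f_N$ have the almost everywhere phase retrieval property if and only if for any $I,J\subset\{1,\dots,N\}$ with $I\cup J=\{1,\dots,N\}$, $$V_I^\perp+V_J^\perp\neq\mathbb{R}^d.$$ In particular, $f_1,\dots,f_{d+1}\in\mathbb{R}^d$ have the almost everywhere phase retrieval property if and only if they are full spark, i.e. any $d$ vectors among them are linearly independent.
   Context: $V_J^\perp$ denotes the orthogonal complement of $V_J$ in $\mathbb{R}^d$. Vectors $f_1,\dots,f_N\in\mathbb{R}^d$ have the almost everywhere phase retrieval property if the matrices $A_j=f_jf_j^{T}$ do, i.e. if for Lebesgue-almost every $x\in\mathbb{R}^d$ the following holds: whenever $y\in\mathbb{R}^d$ satisfies $|\langle f_j,y\rangle|=|\langle f_j,x\rangle|$ for all $1\le j\le N$, then $y=x$ or $y=-x$.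
   Formalization: The condition on V_I^⊥+V_J^⊥ is required only for I, J with V_I and V_J both different from R^d (as printed, I={1,…,N}, J=∅ always violates it), and the full spark equivalence is stated for d ≥ 2 (for d=1 the family 1, 0 is a counterexample). *)

(* Defs.v *)
From HB Require Import structures.
From mathcomp Require Import all_boot all_order all_algebra.
From mathcomp Require Import all_classical all_reals all_analysis.

Set Implicit Arguments.
Unset Strict Implicit.
Unset Printing Implicit Defensive.

Import Order.TTheory GRing.Theory Num.Theory.

Local Open Scope classical_set_scope.
Local Open Scope ring_scope.

Section cons_measure.
Local Open Scope ereal_scope.
Context d (T : measurableType d) (R : realType) (n : nat).
Variables (m : {sigma_finite_measure set T -> \bar R})
          (mn : {sigma_finite_measure set (n.-tuple T) -> \bar R}).

Let consp (z : T * n.-tuple T) := [the n.+1.-tuple T of z.1 :: z.2].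
Let uncons (t : n.+1.-tuple T) := (thead t, [tuple of behead t]).

Let measurable_consp : measurable_fun [set: T * n.-tuple T] consp.
Proof. exact: measurable_cons. Qed.

Let measurable_uncons : measurable_fun [set: n.+1.-tuple T] uncons.
Proof.
apply: measurable_fun_pair; first exact: measurable_tnth.
exact: measurable_behead.
Qed.

Definition cons_measure : set (n.+1.-tuple T) -> \bar R :=
  pushforward (m \x mn) consp.

Let cons_measure0 : cons_measure set0 = 0.
Proof. by rewrite /cons_measure /pushforward preimage_set0 measure0. Qed.

Let cons_measure_ge0 A : 0 <= cons_measure A.
Proof. exact: measure_ge0. Qed.

Let cons_measure_sigma_additive : semi_sigma_additive cons_measure.
Proof.
move=> F mF tF mUF; rewrite /cons_measure /pushforward preimage_bigcup.
apply: measure_semi_sigma_additive.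
- by move=> i; rewrite -[X in measurable X]setTI; exact: measurable_consp.
- apply/trivIsetP => /= i j _ _ ij; rewrite -preimage_setI.
  by move/trivIsetP : tF => /(_ _ _ _ _ ij) ->//; rewrite preimage_set0.
- rewrite -preimage_bigcup -[X in measurable X]setTI.
  exact: measurable_consp.
Qed.

HB.instance Definition _ := isMeasure.Build _ _ _ cons_measure
  cons_measure0 cons_measure_ge0 cons_measure_sigma_additive.

Lemma cons_measureE (A : set T) (B : set (n.-tuple T)) :
  measurable A -> measurable B ->
  cons_measure [set t | A (thead t) /\ B [tuple of behead t]] = m A * mn B.
Proof.
move=> mA mB; rewrite /cons_measure /pushforward -product_measure1E //.
congr (_ _); apply/seteqP; split => -[a b] /=;
  by rewrite theadE (_ : [tuple of behead (consp (a, b))] = b :> n.-tuple T) //;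
     apply/val_inj.
Qed.

Let cons_measure_sigma_finite : sigma_finite [set: n.+1.-tuple T] cons_measure.
Proof.
have /sigma_finiteP[F [FT ndF Foo]] := sigma_finiteT m.
have /sigma_finiteP[G [GT ndG Goo]] := sigma_finiteT mn.
exists (fun k => uncons @^-1` (F k `*` G k)).
  rewrite -preimage_bigcup (_ : \bigcup_k _ = setT) ?preimage_setT //.
  rewrite -setXTT FT GT predeqE => -[x y]; split.
    by move=> [k _ []/= ? ?]; split; exists k.
  move=> [/= [k _ Fkx] [l _ Gly]]; exists (maxn k l) => //; split.
  - by move: x Fkx; exact/subsetPset/ndF/leq_maxl.
  - by move: y Gly; exact/subsetPset/ndG/leq_maxr.
move=> k; have [mF Fk] := Foo k; have [mG Gk] := Goo k; split.
  rewrite -[X in measurable X]setTI.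
  by apply: measurable_uncons => //; exact: measurableX.
rewrite [ltLHS](cons_measureE mF mG) lte_mul_pinfty ?ge0_fin_numE //.
Qed.

HB.instance Definition _ := Measure_isSigmaFinite.Build _ _ _ cons_measure
  cons_measure_sigma_finite.

End cons_measure.

Section lebesgue_tuple.
Variable R : realType.

(* n-dimensional Lebesgue measure, as the n-fold product of the Lebesgue       *)
(* measure of R on the product sigma-algebra; lebesgue_tuple_box checks its    *)
(* value on boxes. Almost-everywhere statements are the same for this measure  *)
(* and for its completion, since negligible sets need not be measurable.       *)
Fixpoint lebesgue_tuple (n : nat) :
    {sigma_finite_measure set (n.-tuple (measurableTypeR R)) -> \bar R} :=
  if n is n'.+1
  then cons_measure (@lebesgue_measure R) (lebesgue_tuple n')
  else \d_([tuple] : 0.-tuple (measurableTypeR R)).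

Lemma lebesgue_tuple_box n (A : 'I_n -> set (measurableTypeR R)) :
  (forall i, measurable (A i)) ->
  lebesgue_tuple n [set t | forall i, A i (tnth t i)] =
  (\prod_(i < n) lebesgue_measure (A i))%E.
Proof.
have tb k (t : k.+1.-tuple (measurableTypeR R)) i :
    tnth [tuple of behead t] i = tnth t (lift ord0 i).
  by rewrite [in RHS](tuple_eta t) tnthS.
elim: n A => [|n IH] A mA.
  by rewrite big_ord0 /= diracE mem_set // => -[].
rewrite big_ord_recl -(IH (A \o lift ord0)) => [|i]; last exact: mA.
rewrite -cons_measureE //.
- congr (_ _); apply/seteqP; split => t /=.
    by move=> At; split=> [|i]; [exact: At | rewrite tb; exact: At].
  move=> [At0 Atb] i; case: (unliftP ord0 i) => [j|] -> //.
  by rewrite -tb; exact: Atb.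
- rewrite (_ : [set t | _] =
      \bigcap_(i in [set: 'I_n]) (@tnth n _ ^~ i) @^-1` A (lift ord0 i)).
    apply: fin_bigcap_measurable => // i _.
    by rewrite -[X in measurable X]setTI; apply: measurable_tnth.
  by apply/seteqP; split => t /= At i => [_|]; exact: At.
Qed.

End lebesgue_tuple.

Section dot_product.
Variables (R : realType) (d : nat).
Implicit Types u v : 'rV[R]_d.

Definition dotv u v : R := \sum_i u 0 i * v 0 i.

Let dotv_is_bilinear :
  bilinear_for (GRing.Scale.Law.clone _ _ *%R _)
    (GRing.Scale.Law.clone _ _ (idfun \; *%R) _) dotv.
Proof.
split=> [v|u] a x y; rewrite /dotv /= mulr_sumr -big_split /=;
  by apply: eq_bigr => i _; rewrite !mxE ?mulrDl ?mulrDr -?mulrA // mulrCA.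
Qed.

HB.instance Definition _ := bilinear_isBilinear.Build R _ _ _ _ _ dotv
  dotv_is_bilinear.

Let dotv_is_hermitian u v : dotv u v = (-1) ^+ false * idfun (dotv v u).
Proof.
by rewrite expr0 mul1r /dotv; apply: eq_bigr => i _; rewrite mulrC.
Qed.

HB.instance Definition _ := isHermitianSesquilinear.Build R _ false idfun dotv
  dotv_is_hermitian.
End dot_product.

Section phase_retrieval.
Variables (R : realType) (d N : nat) (f : 'I_N -> 'rV[R]_d).

Definition vec_of_tuple (t : d.-tuple (measurableTypeR R)) : 'rV[R]_d :=
  \row_i tnth t i.

Definition ae_phase_retrieval : Prop :=
  \forall t \ae lebesgue_tuple R d, forall y : 'rV[R]_d,
    (forall j, `|dotv (f j) y| = `|dotv (f j) (vec_of_tuple t)|) ->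
    y = vec_of_tuple t \/ y = - vec_of_tuple t.

Definition subfamily_span (J : {set 'I_N}) : {vspace 'rV[R]_d} :=
  <<[seq f j | j in J]>>%VS.

(* Repeated vectors are kept in the list, so two equal vectors with distinct   *)
(* indices count as linearly dependent.                                        *)
Definition full_spark : Prop :=
  forall J : {set 'I_N}, #|J| = d -> free [seq f j | j in J].

End phase_retrieval.

Definition orthogonal_complement (R : realType) (d : nat)
    (V : {vspace 'rV[R]_d}) : {vspace 'rV[R]_d} :=
  orthov (@dotv R d : {hermitian 'rV[R]_d for false & idfun}) V.

(* Main.v *)
Require Import Defs.
From mathcomp Require Import all_boot all_order all_algebra.
From mathcomp Require Import all_classical all_reals all_analysis.
From mathcomp Require Import measurable_realfun.
From mathcomp Require Import zify.

Set Implicit Arguments.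
Unset Strict Implicit.
Unset Printing Implicit Defensive.
Import Order.TTheory GRing.Theory Num.Theory.
Local Open Scope ring_scope.

(** If y has the same magnitudes |<f_j, y>| = |<f_j, x>| as x, then factoring
    the difference of squares gives <f_j, x - y> <f_j, x + y> = 0 for every j:
    each index kills one of the two factors, so the indices split into a cover
    I, J with x - y in V_I^perp and x + y in V_J^perp ([same_magnitudesP]).
    Conversely any u in V_I^perp and w in V_J^perp make u + w and w - u
    indistinguishable. Hence the vectors x that are not determined up to sign
    are exactly the sums u + w with u and w nonzero, over the finitely many
    covers (I, J).

    If V_I^perp + V_J^perp is proper whenever both summands are nonzero, these
    vectors lie in a finite union of proper subspaces, which is negligible: a
    proper subspace lies in a hyperplane, and hyperplanes are null by induction
    on the dimension and Fubini ([lebesgue_hyperplane0]). If on the contrary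
    some cover has nonzero summands with sum R^d, almost every vector is a sum
    of two nonzero ones ([add_decomposition_neq0]), so recovery fails almost
    everywhere ([ae_phase_retrievalP]).

    For d + 1 vectors, duality turns the criterion into linear algebra:
    dim (V_I^perp + V_J^perp) = d - dim (V_I :&: V_J). Full spark gives
    dim V_K = min(#|K|, d), so proper V_I and V_J have orthogonal complements of
    total dimension 2d - #|I| - #|J| <= d - 1. If d of the vectors span a proper
    V_J and f_k is the remaining one, then either f_k is outside V_J and the
    cover (J, {k}) has V_J :&: V_{k} = 0, or the whole family spans only V_J and
    the cover (all indices, empty set) violates the criterion
    ([full_sparkP]). *)

(** * Orthogonal complements for the dot product *)

Section orthogonality.
Variables (R : realType) (d : nat).
Implicit Types (u v : 'rV[R]_d) (U V W : {vspace 'rV[R]_d}).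
Local Notation perp := (@orthogonal_complement R d).

Lemma dotvC u v : dotv u v = dotv v u.
Proof. by apply: eq_bigr => i _; rewrite mulrC. Qed.

Lemma dotv_eq0 u : (dotv u u == 0) = (u == 0).
Proof.
apply/eqP/eqP => [u0|->]; last by rewrite linear0l.
apply/rowP => i; rewrite mxE; apply/eqP; rewrite -sqrf_eq0 expr2; apply/eqP.
apply: (psumr_eq0P _ u0) => // j _; by rewrite -expr2 sqr_ge0.
Qed.

Lemma orthogonal_complementD U V :
  (perp (U + V) = perp U :&: perp V)%VS.
Proof.
apply/vspaceP => u; rewrite memv_cap /orthogonal_complement !memvE.
exact: orthovD.
Qed.

Lemma capv_orthogonal_complement V : (V :&: perp V = 0)%VS.
Proof.
apply/eqP; rewrite -subv0; apply/subvP => u; rewrite memv_cap memv0.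
by move=> /andP[uV /mem_orthovP/(_ u uV)/eqP]; rewrite dotv_eq0.
Qed.

(** Each vector of s imposes one linear equation, hence costs at most one
    dimension. *)
Lemma leq_dim_cap_orthogonal U (s : seq 'rV[R]_d) :
  (\dim U <= \dim (U :&: perp << s >>) + size s)%N.
Proof.
elim: s U => [|v s IH] U.
  by rewrite span_nil /orthogonal_complement orthov0 capvf addn0.
rewrite span_cons orthogonal_complementD capvA /= addnS.
apply: (@leq_trans (\dim (U :&: perp <[v]>)).+1).
  by rewrite (leq_trans (leqSpred _)) ?ltnS ?leq_dim_orthov1.
by rewrite ltnS IH.
Qed.

(** Positive definiteness makes V and its complement independent, which bounds
    the total dimension by d; counting equations bounds it from below. *)
Lemma dim_orthogonal_complement V : (\dim (perp V) + \dim V = d)%N.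
Proof.
have dimT : \dim {:'rV[R]_d} = d by rewrite dimvf /dim /= mul1n.
apply/eqP; rewrite eqn_leq; apply/andP; split.
  rewrite addnC -dimv_disjoint_sum ?capv_orthogonal_complement //.
  by rewrite -[leqRHS]dimT dimvS ?subvf.
have := leq_dim_cap_orthogonal fullv (vbasis V).
by rewrite capfv size_tuple dimT (span_basis (vbasisP V)).
Qed.

(** The dimension form of U^perp + V^perp = (U :&: V)^perp; it follows from
    U^perp :&: V^perp = (U + V)^perp by counting alone. *)
Lemma dim_add_orthogonal_complement U V :
  (\dim (perp U + perp V) + \dim (U :&: V) = d)%N.
Proof.
have := dimv_sum_cap (perp U) (perp V).
rewrite -orthogonal_complementD => e.
have := dim_orthogonal_complement (U + V); have := dimv_sum_cap U V.
have := dim_orthogonal_complement U; have := dim_orthogonal_complement V.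
lia.
Qed.

Lemma eq_fullv_dim V : (V = fullv) <-> (\dim V = d).
Proof.
have dimT : \dim {:'rV[R]_d} = d by rewrite dimvf /dim /= mul1n.
split=> [->|dV]; first by rewrite dimT.
by apply/eqP; rewrite eqEdim subvf dimT dV leqnn.
Qed.

End orthogonality.

(** * Subspaces and Lebesgue measure *)

Section lebesgue_null_sets.
Variable R : realType.
Local Open Scope classical_set_scope.

Lemma dotv_cons d (a : 'rV[R]_d.+1) (t : d.+1.-tuple (measurableTypeR R)) :
  dotv a (vec_of_tuple t) = a 0 0 * thead t +
     dotv (\row_i a 0 (lift ord0 i)) (vec_of_tuple [tuple of behead t]).
Proof.
rewrite /dotv big_ord_recl mxE; congr (_ + _).
apply: eq_bigr => i _; rewrite !mxE; congr (_ * _).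
by rewrite [in LHS](tuple_eta t) tnthS.
Qed.

Lemma measurable_hyperplane d (a : 'rV[R]_d) (c : R) :
  measurable [set t | dotv a (vec_of_tuple t) = c].
Proof.
pose g (t : d.-tuple (measurableTypeR R)) : measurableTypeR R :=
  \sum_i a 0 i * tnth t i.
rewrite (_ : [set _ | _] = setT `&` g @^-1` [set c]).
  suff : measurable_fun setT g by apply => //; exact: measurable_set1.
  apply: measurable_sum => i; apply: measurable_funM => //.
  exact: measurable_tnth.
rewrite setTI; apply/seteqP; split=> t /=; rewrite /g /dotv => <-;
  by apply: eq_bigr => i _; rewrite mxE.
Qed.

(** The hyperplanes are affine because the induction slices along the first
    coordinate: the slice at x is again a hyperplane, with constant c - a_0 x.
    This breaks down only when a is a multiple of the first basis vector; the
    hyperplane is then a point times R^d. *)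
Lemma lebesgue_hyperplane0 d (a : 'rV[R]_d) (c : R) : a != 0 ->
  lebesgue_tuple R d [set t | dotv a (vec_of_tuple t) = c] = 0%E.
Proof.
elim: d a c => [|d IH] a c a0; first by rewrite thinmx0 eqxx in a0.
set b : 'rV[R]_d := \row_i a 0 (lift ord0 i).
have [b0|bN0] := eqVneq b 0.
  have a00 : a 0 0 != 0.
    apply: contra_neq a0 => a00; apply/rowP => i; rewrite mxE.
    case: (unliftP ord0 i) => [j|] -> //.
    by move/rowP : b0 => /(_ j); rewrite !mxE.
  rewrite (_ : [set _ | _] =
      [set t | [set c / a 0 0] (thead t) /\ setT [tuple of behead t]]).
    apply: etrans (cons_measureE lebesgue_measure (lebesgue_tuple R d)
      (measurable_set1 _) measurableT) _.
    by rewrite [X in (X * _)%E]lebesgue_measure_set1 mul0e.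
  apply/seteqP; split=> t /=; rewrite dotv_cons -/b b0 linear0l addr0.
    by move=> <-; split=> //; rewrite mulrC mulKf.
  by move=> [-> _]; rewrite mulrC divfK.
rewrite /= /cons_measure /pushforward /product_measure1.
rewrite -[RHS](integral0 lebesgue_measure setT); apply: eq_integral => x _ /=.
rewrite -(IH b (c - a 0 0 * x)) //; congr (lebesgue_tuple R d _).
have dot_cons (t : d.-tuple (measurableTypeR R)) :
    dotv a (vec_of_tuple [tuple of x :: t]) =
    a 0 0 * x + dotv b (vec_of_tuple t).
  rewrite dotv_cons theadE (_ : [tuple of behead [tuple of x :: t]] = t) //.
  exact/val_inj.
apply/seteqP; split=> t; rewrite /xsection /= inE /= dot_cons.
  by move=> <-; rewrite addrAC subrr add0r.
by move=> ->; rewrite addrC subrK.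
Qed.

(** The box [1, 2]^d has measure 1 and misses the origin. *)
Lemma ae_exists_neq0 d (P : 'rV[R]_d -> Prop) : (0 < d)%N ->
  (\forall t \ae lebesgue_tuple R d, P (vec_of_tuple t)) ->
  exists2 x, x != 0 & P x.
Proof.
move=> d0 [B [mB B0 PB]]; apply: contrapT => nP.
pose A (_ : 'I_d) : set (measurableTypeR R) := `[1%R, 2%R]%classic.
have mA i : measurable (A i) by exact: measurable_itv.
have : (lebesgue_tuple R d [set t | forall i, A i (tnth t i)] = 1)%E.
  rewrite lebesgue_tuple_box // big1 // => i _; rewrite /A.
  rewrite lebesgue_measure_itv /= lte_fin ltr1n /= -EFinB.
  by congr EFin; rewrite -[X in X - _]/(1+1) addrK.
suff -> : (lebesgue_tuple R d [set t | forall i, A i (tnth t i)] = 0)%E.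
  by move=> /eqP; rewrite eq_sym onee_eq0.
apply: (subset_measure0 _ mB _ B0).
  rewrite (_ : [set t | _] =
      \bigcap_(i in [set: 'I_d]) (@tnth d _ ^~ i) @^-1` A i).
    apply: fin_bigcap_measurable => // i _.
    by rewrite -[X in measurable X]setTI; apply: measurable_tnth.
  by apply/seteqP; split => t /= At i => [_|]; exact: At.
move=> t At; apply: PB => /= Pt; apply: nP; exists (vec_of_tuple t) => //.
apply/eqP => /rowP/(_ (Ordinal d0)); rewrite !mxE => t0.
by have := At (Ordinal d0); rewrite /A /= t0 in_itv /= ler10.
Qed.

Lemma ae_notin_proper d (V : {vspace 'rV[R]_d}) : V <> fullv ->
  \forall t \ae lebesgue_tuple R d, vec_of_tuple t \notin V.
Proof.
move=> VT.
have : orthogonal_complement V != 0%VS.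
  apply/eqP => V0; have := dim_orthogonal_complement V.
  by rewrite V0 dimv0 add0n => /eq_fullv_dim.
rewrite -vpick0; set a := vpick _ => a0.
exists [set t | dotv a (vec_of_tuple t) = 0]; split.
- exact: measurable_hyperplane.
- exact: lebesgue_hyperplane0.
- move=> t /= /negP; rewrite negbK => tV.
  by have /mem_orthovP/(_ _ tV) := memv_pick (orthogonal_complement V).
Qed.
End lebesgue_null_sets.

(** * The criterion by pairs of spans *)

Section phase_retrieval.
Variables (R : realType) (d N : nat) (f : 'I_N -> 'rV[R]_d).
Local Notation perp J := (orthogonal_complement (subfamily_span f J)).

Lemma mem_perp_subfamily (J : {set 'I_N}) u :
  u \in perp J <-> {in J, forall j, dotv (f j) u = 0}.
Proof.
split=> [/mem_orthovP uJ j jJ|uJ].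
  by rewrite dotvC uJ // memv_span // map_f // mem_enum.
apply/mem_orthovP => v vJ; rewrite [LHS]dotvC.
suff /subvP/(_ v vJ) : (subfamily_span f J <= orthogonal_complement <[u]>)%VS.
  by rewrite mem_orthov1 => /eqP.
apply/span_subvP => _ /mapP[j jJ ->]; rewrite mem_orthov1; apply/eqP/uJ.
by rewrite mem_enum in jJ.
Qed.

(** I and J collect the indices at which the first, respectively the second,
    factor of <f_j, x>^2 - <f_j, y>^2 = <f_j, x - y> <f_j, x + y> vanishes. *)
Lemma same_magnitudesP (x y : 'rV[R]_d) :
  (forall j, `|dotv (f j) y| = `|dotv (f j) x|) <->
  exists I J : {set 'I_N}, [/\ (I :|: J = [set: 'I_N])%SET,
    x - y \in perp I & x + y \in perp J].
Proof.
split=> [xy|[I [J [IJ /mem_perp_subfamily xyI /mem_perp_subfamily xyJ]]] j].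
  exists [set j | dotv (f j) (x - y) == 0]%SET.
  exists [set j | dotv (f j) (x + y) == 0]%SET; split.
  - apply/setP => j; rewrite !inE -mulf_eq0 linearBr linearDr -subr_sqr.
    rewrite -[X in X - _]real_normK ?num_real // -xy.
    by rewrite real_normK ?num_real // subrr eqxx.
  - by apply/mem_perp_subfamily => j; rewrite inE => /eqP.
  - by apply/mem_perp_subfamily => j; rewrite inE => /eqP.
have : j \in (I :|: J)%SET by rewrite IJ inE.
rewrite inE => /orP[/xyI|/xyJ]; rewrite ?linearBr ?linearDr => /eqP.
  by rewrite subr_eq0 => /eqP ->.
by rewrite addr_eq0 => /eqP ->; rewrite normrN.
Qed.

(** A decomposition of x with a zero summand puts x in U or in W. Outside the
    proper ones among U and W this is excluded, and a summand that is the full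
    space leaves enough freedom to choose the other one nonzero and different
    from x. *)
Lemma add_decomposition_neq0 (U W : {vspace 'rV[R]_d}) x :
  U != 0%VS -> W != 0%VS -> (U + W)%VS = fullv -> x != 0 ->
  (U <> fullv -> x \notin U) -> (W <> fullv -> x \notin W) ->
  exists u w, [/\ u \in U, w \in W, u != 0, w != 0 & x = u + w].
Proof.
move=> U0 W0 UW x0 xU xW.
have exists_avoiding (A : {vspace 'rV[R]_d}) : A != 0%VS ->
    exists2 a, a \in A & a != 0 /\ x - a != 0.
  rewrite -vpick0; have := memv_pick A; set a := vpick A => aA a0.
  have [ax|ax] := eqVneq a x; last first.
    by exists a => //; split=> //; rewrite subr_eq0 eq_sym.
  (* Here a = x, and 2 x avoids x since x <> 0. *)
  exists (a + a); first by rewrite memvD.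
  rewrite ax opprD addrA subrr add0r oppr_eq0; split=> //.
  by rewrite -mulr2n -scaler_nat scaler_eq0 pnatr_eq0.
have : x \in (U + W)%VS by rewrite UW memvf.
move=> /memv_addP[u uU [w wW xuw]].
have [u0|u0] := eqVneq u 0.
  have xinW : x \in W by rewrite xuw u0 add0r.
  have WT : W = fullv by apply: contrapT => /xW; rewrite xinW.
  have [a aU [a0 xa0]] := exists_avoiding U U0.
  by exists a, (x - a); split; rewrite ?WT ?memvf // addrC subrK.
have [w0|w0] := eqVneq w 0; last by exists u, w.
have xinU : x \in U by rewrite xuw w0 addr0.
have UT : U = fullv by apply: contrapT => /xU; rewrite xinU.
have [a aW [a0 xa0]] := exists_avoiding W W0.
by exists (x - a), a; split; rewrite ?UT ?memvf ?subrK.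
Qed.

Lemma ae_phase_retrievalP :
  ae_phase_retrieval f <->
     (forall I J : {set 'I_N}, (I :|: J)%SET = [set: 'I_N]%SET ->
        subfamily_span f I <> fullv -> subfamily_span f J <> fullv ->
        (perp I + perp J)%VS <> fullv).
Proof.
have perp_neq0 V : V <> fullv <-> @orthogonal_complement R d V != 0%VS.
  have dV := dim_orthogonal_complement V; rewrite eq_fullv_dim -dimv_eq0; lia.
split=> [pr I J IJ /perp_neq0 I0 /perp_neq0 J0 sumT|cond].
  have d0 : (0 < d)%N.
    rewrite lt0n; apply: contra_neq I0 => d0; apply/eqP; rewrite -dimv_eq0.
    by have := dim_orthogonal_complement (subfamily_span f I); lia.
  have aeN V : \forall t \ae lebesgue_tuple R d,
      V <> fullv -> vec_of_tuple t \notin V.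
    have [VT|VT] := pselect (V = fullv); first exact: filterE.
    by apply: filterS (ae_notin_proper VT) => t.
  have [|x x0] := @ae_exists_neq0 R d (fun x => [/\ forall y,
      (forall j, `|dotv (f j) y| = `|dotv (f j) x|) -> y = x \/ y = - x,
      perp I <> fullv -> x \notin perp I &
      perp J <> fullv -> x \notin perp J]) d0.
    by apply: filterS3 pr (aeN (perp I)) (aeN (perp J)) => t.
  case=> prx xI xJ.
  have [u [w [uI wJ u0 w0 xuw]]] := add_decomposition_neq0 I0 J0 sumT x0 xI xJ.
  (* For y = w - u, x - y = 2 u and x + y = 2 w. *)
  have : forall j, `|dotv (f j) (w - u)| = `|dotv (f j) x|.
    apply/same_magnitudesP; exists I, J; split=> //.
      by rewrite xuw opprB addrACA subrr addr0 memvD.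
    by rewrite xuw [w - u]addrC addrACA subrr add0r memvD.
  have oppN (v : 'rV[R]_d) : v != 0 -> v <> - v.
    move=> v0 /eqP; rewrite -addr_eq0 -mulr2n -scaler_nat scaler_eq0.
    by rewrite pnatr_eq0 (negPf v0).
  move=> /prx[|]; rewrite xuw.
    by rewrite [RHS]addrC => /addrI/esym; exact: oppN.
  by rewrite opprD addrC => /addrI; exact: oppN.
(* Covers are packed as pairs, which form a finite type, so that the almost
   everywhere statements can be intersected. *)
have good (p : {set 'I_N} * {set 'I_N}) : \forall t \ae lebesgue_tuple R d,
    (p.1 :|: p.2)%SET = [set: 'I_N]%SET ->
    perp p.1 != 0%VS -> perp p.2 != 0%VS ->
    vec_of_tuple t \notin (perp p.1 + perp p.2)%VS.
  have [[pT p1 p2]|np] := pselect [/\ (p.1 :|: p.2)%SET = [set: 'I_N]%SET,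
      perp p.1 != 0%VS & perp p.2 != 0%VS]; last first.
    by apply: filterE => t pT p1 p2; case: np.
  have /ae_notin_proper : (perp p.1 + perp p.2)%VS <> fullv.
    by apply: cond => //; exact/perp_neq0.
  exact: filterS.
apply: (filterS _ (filter_forall _ good)) => t goodt y /same_magnitudesP.
move=> [I [J [IJ xyI xyJ]]]; set x := vec_of_tuple t in xyI xyJ *.
have [xy0|xyN0] := eqVneq (x - y) 0; first by left; apply/esym/subr0_eq.
have [xy0|xypN0] := eqVneq (x + y) 0.
  by right; apply/eqP; rewrite -addr_eq0 addrC xy0.
have neq0 (V : {vspace 'rV[R]_d}) v : v \in V -> v != 0 -> V != 0%VS.
  by move=> vV; apply: contra_neq => V0; apply/eqP; rewrite -memv0 -V0.
have /negP[] := goodt (I, J) IJ (neq0 _ _ xyI xyN0) (neq0 _ _ xyJ xypN0).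
have -> : vec_of_tuple t = 2^-1 *: ((x - y) + (x + y)).
  rewrite addrACA addNr addr0 -/x -[x + x]mulr2n -[x *+ 2]scaler_nat scalerA.
  by rewrite mulVf ?scale1r ?pnatr_eq0.
by rewrite memvZ // memv_add.
Qed.

End phase_retrieval.

(** * Full spark families of d + 1 vectors *)

Section full_spark.
Variables (R : realType) (d N : nat) (f : 'I_N -> 'rV[R]_d).

Lemma subfamily_spanU (I J : {set 'I_N}) :
  subfamily_span f (I :|: J)%SET = (subfamily_span f I + subfamily_span f J)%VS.
Proof.
rewrite -span_cat; apply: eq_span => v; rewrite mem_cat.
apply/fintype.imageP/orP => [[j]|[]/fintype.imageP[j jIJ ->]]; last 2 first.
- by exists j => //; rewrite inE jIJ.
- by exists j => //; rewrite inE jIJ orbT.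
by rewrite inE => /orP[jI|jJ] ->; [left|right]; apply/fintype.imageP; exists j.
Qed.

Lemma dim_subfamily_span_leq (J : {set 'I_N}) :
  (\dim (subfamily_span f J) <= #|J|)%N.
Proof. by rewrite (leq_trans (dim_span _)) // size_map -cardE. Qed.

Lemma ex_subset_card (T : finType) (A : {set T}) n : (n <= #|A|)%N ->
  exists2 B : {set T}, B \subset A & #|B| = n.
Proof.
rewrite -bin_gt0 -cards_draws => /card_gt0P[B]; rewrite !inE.
by move=> /andP[BA /eqP Bn]; exists B.
Qed.

(** A smaller J extends to d independent vectors, and adding d - #|J| vectors
    raises the dimension by at most that much; a larger J contains d independent
    vectors. *)
Lemma dim_subfamily_span_full_spark (J : {set 'I_N}) :
  (d <= N)%N -> full_spark f ->
  \dim (subfamily_span f J) = minn #|J| d.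
Proof.
move=> dN fs; have dimT : \dim {:'rV[R]_d} = d by exact/eq_fullv_dim.
have Jd := dimvS (subvf (subfamily_span f J)); rewrite dimT in Jd.
have fsK (K : {set 'I_N}) : #|K| = d -> \dim (subfamily_span f K) = d.
  by move=> Kd; rewrite (eqP (fs K Kd)) size_map -cardE.
apply/eqP; rewrite eqn_leq leq_min dim_subfamily_span_leq Jd /=.
have [dJ|Jltd] := leqP d #|J|.
  have [B BJ Bd] := ex_subset_card dJ.
  rewrite -[leqLHS](fsK B Bd) -(finset.setUidPr BJ) subfamily_spanU.
  by rewrite dimvS // addvSl.
have [|B BJ Bd] := @ex_subset_card _ (~: J)%SET (d - #|J|).
  by rewrite [leqRHS]cardsCs finset.setCK card_ord leq_sub2r.
have JB0 : (J :&: B = finset.set0)%SET.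
  by apply/eqP; rewrite finset.setI_eq0 disjoint_sym finset.disjoints_subset.
have := fsK (J :|: B)%SET; rewrite subfamily_spanU cardsU JB0 cards0 Bd.
have := (dimv_add_leqif (subfamily_span f J) (subfamily_span f B)).1.
have := dim_subfamily_span_leq B; rewrite Bd; lia.
Qed.

End full_spark.

(** For d = 1 the pair (J, {k}) used for the converse may fail to have a proper
    second span, which is where 1 < d enters. *)
Lemma full_sparkP (R : realType) (d : nat) (f : 'I_d.+1 -> 'rV[R]_d) :
  (1 < d)%N -> full_spark f <->
     (forall I J : {set 'I_d.+1}, (I :|: J)%SET = [set: 'I_d.+1]%SET ->
        subfamily_span f I <> fullv -> subfamily_span f J <> fullv ->
        (orthogonal_complement (subfamily_span f I) +
         orthogonal_complement (subfamily_span f J))%VS <> fullv).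
Proof.
move=> d1; split=> [fs I J IJ|cond J Jd].
  have dimV K := dim_subfamily_span_full_spark K (leqnSn d) fs.
  rewrite !eq_fullv_dim !dimV => Id Jd.
  have dI := dim_orthogonal_complement (subfamily_span f I).
  have dJ := dim_orthogonal_complement (subfamily_span f J).
  have := (dimv_add_leqif (orthogonal_complement (subfamily_span f I))
    (orthogonal_complement (subfamily_span f J))).1.
  have := cardsUI I J; rewrite IJ cardsT card_ord.
  rewrite !dimV in dI dJ; lia.
rewrite /free size_map -cardE Jd; apply/eqP/eq_fullv_dim.
apply: contrapT => VJ.
have [k kJ] : exists k, k \notin J.
  apply/existsP; rewrite -negb_forall; apply/negP => /forallP JT.
  have JE : J = [set: _]%SET by apply/setP => i; rewrite inE JT.
  by move: Jd; rewrite JE cardsT card_ord; lia.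
have JkT : (J :|: [set k])%SET = [set: _]%SET.
  apply/eqP; rewrite eqEcard finset.subsetT cardsT card_ord.
  by rewrite finset.setUC cardsU1 kJ Jd add1n leqnn.
have Vk : subfamily_span f [set k]%SET = <[f k]>%VS.
  by rewrite /subfamily_span /image_mem enum_set1 /= span_seq1.
have lt_dim_proper (V : {vspace 'rV[R]_d}) : (\dim V < d)%N -> V <> fullv.
  by move=> Vd /eq_fullv_dim; lia.
have cap_neq0 I K : (I :|: K)%SET = [set: 'I_d.+1]%SET ->
    subfamily_span f I <> fullv -> subfamily_span f K <> fullv ->
    (subfamily_span f I :&: subfamily_span f K)%VS != 0%VS.
  move=> IK VI VK; apply/eqP => cap0; apply: (cond I K) => //.
  have := dim_add_orthogonal_complement (subfamily_span f I)
    (subfamily_span f K).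
  by rewrite cap0 dimv0 addn0 => /eq_fullv_dim.
have [fkJ|fkJ] := boolP (f k \in subfamily_span f J).
  have V0 : subfamily_span f finset.set0 = 0%VS.
    apply/eqP; rewrite -dimv_eq0 -leqn0.
    by rewrite (leq_trans (dim_subfamily_span_leq _ _)) ?cards0.
  have VT : subfamily_span f [set: _]%SET = subfamily_span f J.
    by rewrite -JkT subfamily_spanU Vk (addv_idPl _).
  have /negP[] : (subfamily_span f [set: _]%SET :&:
      subfamily_span f finset.set0)%VS != 0%VS.
    apply: cap_neq0; rewrite ?finset.setU0 ?VT //.
    by apply: lt_dim_proper; rewrite V0 dimv0; lia.
  by rewrite V0 capv0.
suff : (subfamily_span f J :&: subfamily_span f [set k]%SET)%VS == 0%VS.
  apply/negP/cap_neq0 => //; apply: lt_dim_proper.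
  by rewrite (leq_ltn_trans (dim_subfamily_span_leq _ _)) ?cards1.
rewrite Vk -subv0; apply/subvP => v; rewrite memv_cap memv0.
move=> /andP[vJ /vlineP[a va]]; move: vJ; rewrite va.
have [->|a0] := eqVneq a 0; first by rewrite scale0r.
by rewrite rpredZeq (negPf a0) (negPf fkJ).
Qed.

(* The requirement that V_I and V_J be proper subspaces excludes only the pairs
   for which V_I^perp or V_J^perp is zero. Without it the pair (I, J) =
   ({1..N}, {}) gives V_J^perp = R^d, so that the right-hand side never holds.
   For d = 1 the family (1, 0) has the almost everywhere phase retrieval
   property but is not full spark, hence the bound on d in the second part. *)
Theorem theorem5p1 (R : realType) (d : nat) :
  (forall (N : nat) (f : 'I_N -> 'rV[R]_d),
     ae_phase_retrieval f <->
     (forall I J : {set 'I_N}, (I :|: J)%SET = [set: 'I_N]%SET ->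
        subfamily_span f I <> fullv -> subfamily_span f J <> fullv ->
        (orthogonal_complement (subfamily_span f I) +
         orthogonal_complement (subfamily_span f J))%VS <> fullv))
  /\
  ((1 < d)%N ->
   forall f : 'I_d.+1 -> 'rV[R]_d, ae_phase_retrieval f <-> full_spark f).
Proof.
split=> [N f|d1 f]; first exact: ae_phase_retrievalP.
by rewrite ae_phase_retrievalP full_sparkP.
Qed.
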